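(* Let $X$ and $Y$ be Tychonoff $\Delta$-spaces and let $T: C_p(X)\to C_p(Y)$ be a linear continuous bijection. Then $T$ is an isomorphism (a linear homeomorphism) if and only if any of the following conditions holds (that is, for each one of the three conditions, $T$ is an isomorphism if and only if that condition holds): (1) $C_p(X)$ admits a base $\mathcal{U}$ of absolutely convex neighbourhoods of zero such that $\overline{T(U)}\subset 2T(U)$ for each $U\in\mathcal{U}$, where the closure is taken in $C_p(Y)$; (2) $T$ is an open mapping; (3) $C_p(X)$ admits a base $\mathcal{U}$ of absolutely convex closed neighbourhoods of zero such that $T(U)$ is closed in $C_p(Y)$ for each $U\in\mathcal{U}$.
   Context: For a Tychonoff space $X$, $C(X)$ is the vector space of all continuous functions $X\to\mathbb{R}$, and $C_p(X)$ is $C(X)$ with the topology of pointwise convergence. A topological space $X$ is a $\Delta$-space if for every decreasing sequence $\{D_n : n\in\omega\}$ of subsets of $X$ with empty intersection there is a decreasing sequence $\{V_n : n\in\omega\}$ of open subsets of $X$, also with empty intersection, such that $D_n\subset V_n$ for every $n\in\omega$. *)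

(* Defs.v *)
From HB Require Import structures.
From mathcomp Require Import all_boot all_order all_algebra.
From mathcomp Require Import all_classical all_reals all_analysis.

Set Implicit Arguments.
Unset Strict Implicit.
Unset Printing Implicit Defensive.

Import Order.TTheory GRing.Theory Num.Theory.
Import numFieldNormedType.Exports.

Local Open Scope classical_set_scope.
Local Open Scope ring_scope.

(* For the equivalence of [completely_regular_space] with separation by
   continuous real-valued functions, see [uniform_separatorP]. *)
Definition tychonoff_space (X : topologicalType) : Prop :=
  accessible_space X /\ completely_regular_space X.

(* Sequences of sets are ordered by inclusion; "decreasing" is not strict. *)
Definition Delta_space (X : topologicalType) : Prop :=
  forall D : (set X)^nat,
    nonincreasing_seq D -> \bigcap_n D n = set0 ->
    exists V : (set X)^nat,
      [/\ forall n, open (V n), nonincreasing_seq V, \bigcap_n V n = set0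
        & forall n, D n `<=` V n].

Definition Cp (R : realType) (X : topologicalType) : Type :=
  continuousType X R.

Section Cp_structure.
Context (R : realType) (X : topologicalType).
Implicit Types (f g h : continuousType X R) (a b : R).

HB.instance Definition _ := Choice.copy (Cp R X) (continuousType X R).

HB.instance Definition _ := Topological.copy (Cp R X)
  (initial_topology (fun f : continuousType X R => (f : X -> R) : {ptws X -> R})).

Let cst0_continuous : continuous (fun _ : X => 0 : R).
Proof. by move=> x; exact: cvg_cst. Qed.

Let opp_continuous f : continuous (fun x => - f x).
Proof. by move=> x; apply: continuousN; exact: cts_fun. Qed.

Let add_continuous f g : continuous (fun x => f x + g x).
Proof. by move=> x; apply: continuousD; exact: cts_fun. Qed.

Let scale_continuous a f : continuous (fun x => a * f x).
Proof.
by move=> x; apply: continuousM; [exact: cvg_cst | exact: cts_fun].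
Qed.

Definition Cp_zero : Cp R X := mkcts cst0_continuous.
Definition Cp_opp (f : Cp R X) : Cp R X := mkcts (@opp_continuous f).
Definition Cp_add (f g : Cp R X) : Cp R X := mkcts (@add_continuous f g).
Definition Cp_scale (a : R) (f : Cp R X) : Cp R X :=
  mkcts (@scale_continuous a f).

Let Cp_addA : associative Cp_add.
Proof. by move=> f g h; apply/continuousEP => x; exact: addrA. Qed.

Let Cp_addC : commutative Cp_add.
Proof. by move=> f g; apply/continuousEP => x; exact: addrC. Qed.

Let Cp_add0 : left_id Cp_zero Cp_add.
Proof. by move=> f; apply/continuousEP => x; exact: add0r. Qed.

Let Cp_addN : left_inverse Cp_zero Cp_opp Cp_add.
Proof. by move=> f; apply/continuousEP => x; exact: addNr. Qed.

HB.instance Definition _ :=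
  GRing.isZmodule.Build (Cp R X) Cp_addA Cp_addC Cp_add0 Cp_addN.

Let Cp_scaleA a b (f : Cp R X) :
  Cp_scale a (Cp_scale b f) = Cp_scale (a * b) f.
Proof. by apply/continuousEP => x; exact: mulrA. Qed.

Let Cp_scale1 : left_id 1 Cp_scale.
Proof. by move=> f; apply/continuousEP => x; exact: mul1r. Qed.

Let Cp_scaleDr : right_distributive Cp_scale +%R.
Proof. by move=> a f g; apply/continuousEP => x; exact: mulrDr. Qed.

Let Cp_scaleDl (f : Cp R X) : {morph Cp_scale^~ f : a b / a + b}.
Proof. by move=> a b; apply/continuousEP => x; exact: mulrDl. Qed.

HB.instance Definition _ := GRing.Zmodule_isLmodule.Build R (Cp R X)
  Cp_scaleA Cp_scale1 Cp_scaleDr Cp_scaleDl.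

End Cp_structure.

Definition balanced (R : numDomainType) (E : lmodType R) (A : set E) : Prop :=
  forall (r : R) (x : E), `|r| <= 1 -> A x -> A (r *: x).

Definition absolutely_convex (R : numDomainType) (E : lmodType R)
    (A : set E) : Prop :=
  convex_set A /\ balanced A.

(* The members of a base of neighbourhoods need not be open. *)
Definition nbhs_base (E : topologicalType) (x : E) (B : set_system E) : Prop :=
  (forall U, B U -> nbhs x U) /\
  (forall W, nbhs x W -> exists2 U, B U & U `<=` W).

Definition open_mapping (E F : topologicalType) (f : E -> F) : Prop :=
  forall A : set E, open A -> open (f @` A).

Definition homeomorphism (E F : topologicalType) (f : E -> F) : Prop :=
  continuous f /\
  exists g : F -> E, [/\ cancel f g, cancel g f & continuous g].

(* Main.v *)
Require Import Defs.
From mathcomp Require Import all_boot all_order all_algebra.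
From mathcomp Require Import all_classical all_reals all_analysis.
From mathcomp Require Import lra.

Set Implicit Arguments.
Unset Strict Implicit.
Unset Printing Implicit Defensive.

Import Order.TTheory GRing.Theory Num.Theory.
Import numFieldNormedType.Exports.

Local Open Scope classical_set_scope.
Local Open Scope ring_scope.

(** A linear surjection [T] between spaces [C_p] is nearly open: the closure of
    [T(U)] is a neighbourhood of zero whenever [U] is one.  Indeed [U] contains
    the functions vanishing on some finite set, a subspace of finite
    codimension; the closure of its image is a closed subspace of finite
    codimension, and in the finite-dimensional Hausdorff quotient by it the
    image of a convex [U] is absorbing, hence a neighbourhood of zero.  The
    lemma [box_nearly_open] carries this out without quotients, adding the
    points of the finite set one at a time.

    Once near openness is known, any condition that bounds the closure of
    [T(U)] by a multiple of [T(U)], for [U] in a base at zero, makes [T(U)]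
    itself a neighbourhood of zero, so [T] is open by translation and, being a
    continuous bijection, a homeomorphism.  The inclusion of the closure of
    [T(U)] in [2 T(U)] is such a bound; so is closedness of [T(U)], as a
    balanced set is contained in its double.

    Conversely, the sets of functions bounded by [e > 0] on a finite set form a
    base of closed absolutely convex neighbourhoods of zero, and a homeomorphism
    maps closed sets to closed sets. *)

(** * Basic neighbourhoods in the topology of pointwise convergence *)

Section Box.
Context (R : realType) (X : topologicalType).
Implicit Types (f g : Cp R X) (s : seq X) (e : R) (W : set (Cp R X)).

Definition box s e : set (Cp R X) := [set f | {in s, forall x, `|f x| <= e}].

Lemma CpDE f g x : (f + g) x = f x + g x. Proof. by []. Qed.
Lemma CpZE (a : R) f x : (a *: f) x = a * f x. Proof. by []. Qed.
Lemma Cp0E x : (0 : Cp R X) x = 0. Proof. by []. Qed.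

Lemma boxS s t e d : {subset s <= t} -> d <= e -> box t d `<=` box s e.
Proof. by move=> st de f ft x /st/ft/le_trans; exact. Qed.

Lemma box_scale s e a f : 0 < a -> box s (a * e) (a *: f) <-> box s e f.
Proof.
by move=> a0; split=> + x xs => /(_ x xs); rewrite CpZE normrM gtr0_norm//
  ler_pM2l.
Qed.

Lemma box_cons x s e f : box (x :: s) e f <-> `|f x| <= e /\ box s e f.
Proof.
split=> [fb|[fx fb] y].
  split; first by apply: fb; rewrite mem_head.
  by apply: boxS fb => // y ys; rewrite inE ys orbT.
by rewrite inE => /predU1P[->//|]; exact: fb.
Qed.

Lemma Cp_eval_continuous x : continuous (fun f => f x).
Proof.
move=> f.
have fc : {for f, continuous (fun g : Cp R X => (g : {ptws X -> R}))}.
  exact: initial_continuous.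
exact: (continuous_comp fc (@proj_continuous X (fun=> R) x _)).
Qed.

(** For the nontrivial direction, the boxes around [f] generate a filter on the
    space of all functions, and this filter converges pointwise to [f], so it
    refines the neighbourhood filter of [f] in the product topology. *)
Lemma nbhs_Cp f W :
  nbhs f W <-> exists s e, 0 < e /\ forall g, box s e (g - f) -> W g.
Proof.
split=> [|[s [e [e0 sW]]]]; last first.
  apply: (filterS sW).
  have near_x x : \forall g \near f, `|(g - f) x| <= e.
    have : \forall y \near f x, `|y - f x| <= e.
      by near=> y; rewrite distrC; near: y; exact: cvgr_dist_le.
    exact: (@Cp_eval_continuous x f).
  elim: s {sW} => [|x s IH].
    by apply: (@filterE _ (nbhs f) _ [set g | box [::] e (g - f)]) => g y.
  apply: filterS (filterI (near_x x) IH) => g [gx gs].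
  exact/box_cons.
rewrite nbhsE => -[_ [[B oB <-] Bf] BW].
pose D := [set p : seq X * R | 0 < p.2].
pose near_f (p : seq X * R) :=
  [set g : X -> R | {in p.1, forall x, `|g x - f x| <= p.2}].
have FF : Filter (filter_from D near_f).
  apply: filter_from_filter => [|[s d] [t e] /= d0 e0].
    by exists ([::], 1); exact: ltr01.
  exists (s ++ t, Num.min d e); first by rewrite /D/= lt_min d0.
  move=> g gst; split=> x xs.
    by apply: le_trans (gst x _) _; rewrite /= ?mem_cat ?xs// ge_min lexx.
  apply: le_trans (gst x _) _; first by rewrite /= mem_cat xs orbT.
  by rewrite /= ge_min lexx orbT.
have F_f : filter_from D near_f --> ((f : X -> R) : {ptws X -> R}).
  apply/pointwise_cvgP => x A /nbhs_ballP[e e0 eA].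
  exists ([:: x], e / 2); first by rewrite /D/= divr_gt0.
  move=> g /(_ x (mem_head _ _)) gx; apply: eA; rewrite /ball/= distrC.
  by apply: le_lt_trans gx _ => /=; move: e0 => /=; lra.
have [[s e] /= e0 sB] : filter_from D near_f B.
  by apply: F_f; exact: open_nbhs_nbhs.
by exists s, e; split=> // g gs; apply: BW; apply: sB.
Unshelve. all: by end_near. Qed.

Lemma box_nbhs0 s e : 0 < e -> nbhs (0 : Cp R X) (box s e).
Proof. by move=> e0; apply/nbhs_Cp; exists s, e; split=> // g; rewrite subr0. Qed.

Lemma nbhs0_box W :
  nbhs (0 : Cp R X) W -> exists s e, 0 < e /\ box s e `<=` W.
Proof.
move=> /nbhs_Cp[s [e [e0 sW]]]; exists s, e; split=> // g gs.
by apply: sW; rewrite subr0.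
Qed.

Lemma box_absolutely_convex s e : absolutely_convex (box s e).
Proof.
split=> [f g k /set_mem fs /set_mem gs|r f r1 fs x xs]; last first.
  by rewrite CpZE normrM -[e]mul1r; apply: ler_pM => //; exact: fs.
apply/mem_set => x xs; have {fs} fx := fs x xs; have {gs} gx := gs x xs.
rewrite CpDE !CpZE (le_trans (ler_normD _ _))// !normrM.
have -> : e = k%:num * e + (1 - k%:num) * e by rewrite -mulrDl subrKC mul1r.
rewrite lerD//.
- by rewrite ger0_norm ?ler_wpM2l.
- by rewrite ger0_norm ?ler_wpM2l// subr_ge0.
Qed.

Lemma box_closed s e : closed (box s e).
Proof.
have -> : box s e =
    \bigcap_(x in [set` s]) (fun f : Cp R X => f x) @^-1` [set y | `|y| <= e].
  by apply/seteqP; split=> f fs x xs; exact: (fs x xs).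
apply: closed_bigI => x _.
apply: (proj1 (continuous_closedP _) (@Cp_eval_continuous x)).
exact: (proj1 (continuous_closedP _) (@norm_continuous R R) _
  (@closed_le R e)).
Qed.

End Box.

(** * Near openness of linear surjections *)

Section NearlyOpen.
Context (R : realType) (X Y : topologicalType).
Context (T : {linear Cp R X -> Cp R Y}) (surjT : forall g, exists f, T f = g).

(** Every [g] in [box t d] is a limit of images of functions from [box s e].
    The induction adds one point [x] to [s], and there are two cases.  Either
    the value at [x] is not controlled by the values on [s] and the finitely
    many values of [T f]; then an approximating [f] can be corrected to vanish
    at [x] at small cost elsewhere.  Or it is controlled, and then the
    smallness of [f x] comes for free with that of [f] on [s] and of [T f]. *)
Lemma box_nearly_open s e : 0 < e -> exists t d, 0 < d /\
  forall g, box t d g -> forall t' d', 0 < d' ->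
    exists2 f, box s e f & box t' d' (T f - g).
Proof.
elim: s e => [|x s IH] e e0.
  exists [::], 1; split=> [|g _ t' d' d'0]; first exact: ltr01.
  have [f <-] := surjT g; exists f => // y _.
  by rewrite subrr Cp0E normr0 ltW.
have [free|] := pselect (forall t d e, 0 < d -> 0 < e ->
    exists f, [/\ box s e f, box t d (T f) & 1 <= `|f x|]).
  have e20 : 0 < e / 2 by rewrite divr_gt0.
  have [t [d [d0 near]]] := IH _ e20; exists t, d; split=> // g gt t' d' d'0.
  have d'20 : 0 < d' / 2 by rewrite divr_gt0.
  have [f fs fg] := near g gt t' _ d'20.
  have [fx0|fx0] := eqVneq (f x) 0.
    exists f; last by apply: boxS fg => //; lra.
    apply/box_cons; rewrite fx0 normr0 ltW//; split=> //.
    by apply: boxS fs => //; lra.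
  have nfx0 : 0 < `|f x|^-1 by rewrite invr_gt0 normr_gt0.
  have [h [hs ht hx]] := free t' (`|f x|^-1 * (d' / 2)) (`|f x|^-1 * (e / 2))
    (mulr_gt0 nfx0 d'20) (mulr_gt0 nfx0 e20).
  have hx0 : h x != 0 by rewrite -normr_gt0 (lt_le_trans ltr01).
  (* [c] is chosen so that [f + c *: h] vanishes at [x]. *)
  pose c := - (f x / h x).
  have cf : `|c| <= `|f x|.
    rewrite normrN normrM normfV ler_pdivrMr ?normr_gt0//.
    by rewrite ler_peMr.
  have scale_le r q : `|r| <= `|f x|^-1 * q -> `|c * r| <= q.
    move=> rq; rewrite normrM; apply: le_trans (ler_pM _ _ cf rq) _ => //.
    by rewrite mulrA divff ?mul1r// normr_eq0.
  exists (f + c *: h).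
    apply/box_cons; split=> [|y ys].
      by rewrite CpDE CpZE mulNr divfK// subrr normr0 ltW.
    rewrite CpDE CpZE (le_trans (ler_normD _ _))// [e]splitr lerD ?fs//.
    exact/scale_le/hs.
  move=> y yt; rewrite linearD linearZ addrAC CpDE CpZE.
  rewrite (le_trans (ler_normD _ _))// [d']splitr lerD ?fg//.
  exact/scale_le/ht.
move=> /existsNP[t0 /existsNP[d0 /existsNP[e1 /not_implyP[d00]]]].
move=> /not_implyP[e10 /forallNP small].
have [|t [d [d_gt0 near]]] := IH (Num.min e (e * e1)).
  by rewrite lt_min e0 mulr_gt0.
have ed0 : 0 < e * d0 / 2 by rewrite divr_gt0// mulr_gt0.
exists (t ++ t0), (Num.min d (e * d0 / 2)); split; first by rewrite lt_min d_gt0.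
move=> g gt t' d' d'0.
(* [T f] is bounded by [e * d0] on [t0]: one half comes from [g], the other
   from the approximation error, hence [t0] enters both boxes. *)
have [||f fs fg] := near g _ (t' ++ t0) (Num.min d' (e * d0 / 2)).
- by apply: boxS gt => [y yt|]; rewrite ?mem_cat ?yt// ge_min lexx.
- by rewrite lt_min d'0.
exists f; last by apply: boxS fg => [y yt|]; rewrite ?mem_cat ?yt// ge_min lexx.
apply/box_cons; split; last by apply: boxS fs => //; rewrite ge_min lexx.
rewrite leNgt; apply/negP => fx.
(* Rescaling by [1 / e] gives a function that contradicts the control [small]
   of the value at [x]. *)
have ei0 : 0 < e^-1 by rewrite invr_gt0.
apply: (small (e^-1 *: f)); split.
- apply/(box_scale _ _ _ e0); rewrite scalerA divff ?gt_eqF// scale1r.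
  by apply: boxS fs => //; rewrite ge_min lexx orbT.
- apply/(box_scale _ _ _ e0); rewrite linearZ scalerA divff ?gt_eqF// scale1r.
  move=> y yt; rewrite -[T f](subrK g) CpDE (le_trans (ler_normD _ _))//.
  rewrite [e * d0]splitr lerD//.
    by rewrite (le_trans (fg y _))// ?mem_cat ?yt ?orbT// ge_min lexx orbT.
  by rewrite (le_trans (gt y _))// ?mem_cat ?yt ?orbT// ge_min lexx orbT.
- by rewrite CpZE normrM gtr0_norm// ler_pdivlMl// mulr1 ltW.
Qed.

Lemma linear_surjection_nearly_open (U : set (Cp R X)) :
  nbhs 0 U -> nbhs 0 (closure (T @` U)).
Proof.
move=> /nbhs0_box[s [e [e0 sU]]].
have [t [d [d0 near]]] := box_nearly_open s e0.
apply: filterS (box_nbhs0 t d0) => g gt A /nbhs_Cp[t' [d' [d'0 t'A]]].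
have [f fs fg] := near g gt t' d' d'0.
by exists (T f); split; [exists f => //; exact: sU|exact: t'A].
Qed.

Lemma linear_open_at0 :
  (forall U : set (Cp R X), nbhs 0 U -> nbhs 0 (T @` U)) -> open_mapping T.
Proof.
move=> T0 A; rewrite !openE => oA _ [f /oA/nbhs_Cp[s [e [e0 sA]]] <-].
have /T0/nbhs0_box[t [d [d0 tT]]] := box_nbhs0 s e0.
apply/nbhs_Cp; exists t, d; split=> // g /tT[h hs Th].
by exists (h + f); [apply: sA; rewrite addrK|rewrite linearD Th subrK].
Qed.

End NearlyOpen.

(** * Openness and homeomorphisms *)

Lemma homeomorphism_open_mapping (E F : topologicalType) (f : E -> F) :
  continuous f -> bijective f -> homeomorphism f <-> open_mapping f.
Proof.
move=> cf [g fg gf].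
have imf A : f @` A = g @^-1` A.
  apply/seteqP; split=> [_ [x Ax <-]|y Agy]; first by rewrite /= fg.
  by exists (g y).
split=> [[_ [g' [fg' g'f /continuousP cg']]] A oA|of_].
  rewrite imf (_ : g = g'); first exact: cg'.
  by apply/funext => y; rewrite -[in RHS](gf y) fg'.
split=> //; exists g; split=> //; apply/continuousP => A oA.
by rewrite -imf; exact: of_.
Qed.

Lemma homeomorphism_closed_mapping (E F : topologicalType) (f : E -> F)
  (A : set E) : homeomorphism f -> closed A -> closed (f @` A).
Proof.
move=> [_ [g [fg gf /continuous_closedP cg]]] /cg.
congr closed; apply/seteqP; split=> [y Agy|_ [x Ax <-]]; last by rewrite /= fg.
by exists (g y).
Qed.

(** * Homeomorphisms and bases at zero *)

Section Base.
Context (R : realType) (X Y : topologicalType).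
Context (T : {linear Cp R X -> Cp R Y}).
Context (ctsT : continuous T) (bijT : bijective T).

Let surjT g : exists f, T f = g.
Proof. by have [h _ hT] := bijT; exists (h g). Qed.

(** The closure of [T @` U] contains a box by near openness, so the hypothesis
    puts half of that box inside [T @` U]. *)
Lemma homeomorphism_of_closure_sub (B : set_system (Cp R X)) :
  nbhs_base 0 B ->
  (forall U, B U -> closure (T @` U) `<=` [set 2 *: g | g in T @` U]) ->
  homeomorphism T.
Proof.
move=> [B0 baseB] clB; apply/homeomorphism_open_mapping => //.
apply: linear_open_at0 => W /baseB[U BU UW].
have /(linear_surjection_nearly_open surjT)/nbhs0_box[t [d [d0 tU]]] := B0 _ BU.
have d20 : 0 < d / 2 by rewrite divr_gt0.
apply: filterS (box_nbhs0 t d20) => g gt.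
have : box t d (2 *: g).
  by rewrite (_ : d = 2 * (d / 2)); [apply/box_scale|lra].
move=> /tU/(clB _ BU)[_ [f Uf <-]] Tfg; exists f; first exact: UW.
by apply: scalerI Tfg; rewrite pnatr_eq0.
Qed.

Lemma homeomorphism_absolutely_convex_base : homeomorphism T ->
  exists B : set_system (Cp R X), [/\ nbhs_base 0 B,
    forall U, B U -> absolutely_convex U /\ closed U
    & forall U, B U -> closed (T @` U)].
Proof.
move=> hT; exists [set U | exists s e, 0 < e /\ U = box s e]; split.
- split=> [_ [s [e [e0 ->]]]|W /nbhs0_box[s [e [e0 sW]]]].
    exact: box_nbhs0.
  by exists (box s e) => //; exists s, e.
- move=> _ [s [e [e0 ->]]]; split; last exact: box_closed.
  exact: box_absolutely_convex.
- move=> _ [s [e [e0 ->]]]; apply: homeomorphism_closed_mapping => //.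
  exact: box_closed.
Qed.

End Base.

(** When [T @` U] is closed, this is the bound on its closure that
    [homeomorphism_of_closure_sub] asks for. *)
Lemma balanced_sub_double (R : numFieldType) (E F : lmodType R)
  (T : {linear E -> F}) (U : set E) :
  balanced U -> T @` U `<=` [set 2 *: g | g in T @` U].
Proof.
move=> balU _ [f Uf <-]; exists (T (2^-1 *: f)).
  exists (2^-1 *: f) => //; apply: balU => //.
  by rewrite ger0_norm ?invr_ge0// invf_le1 ?ler1n.
by rewrite linearZ scalerA divff ?scale1r// pnatr_eq0.
Qed.

(** * The three characterizations *)

Theorem corollary1p4 (R : realType) (X Y : topologicalType)
    (tychX : tychonoff_space X) (tychY : tychonoff_space Y)
    (DeltaX : Delta_space X) (DeltaY : Delta_space Y)
    (T : {linear Cp R X -> Cp R Y})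
    (ctsT : continuous T) (bijT : bijective T) :
  [/\ homeomorphism T <->
        (exists B : set_system (Cp R X),
          [/\ nbhs_base 0 B,
              forall U, B U -> absolutely_convex U
            & forall U, B U ->
                closure (T @` U) `<=` [set 2 *: g | g in T @` U]]),
      homeomorphism T <-> open_mapping T
    & homeomorphism T <->
        (exists B : set_system (Cp R X),
          [/\ nbhs_base 0 B,
              forall U, B U -> absolutely_convex U /\ closed U
            & forall U, B U -> closed (T @` U)])].
Proof.
split.
- split=> [/homeomorphism_absolutely_convex_base[B [baseB acB clB]]|].
    exists B; split=> // [U /acB[]//|U BU].
    have [[_ balU] _] := acB U BU; have /closure_id <- := clB U BU.
    exact: balanced_sub_double.
  by move=> [B [baseB _ clB]]; exact: homeomorphism_of_closure_sub baseB clB.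
- exact: homeomorphism_open_mapping.
- split=> [/homeomorphism_absolutely_convex_base//|[B [baseB acB clB]]].
  apply: (homeomorphism_of_closure_sub ctsT bijT baseB) => U BU.
  have [[_ balU] _] := acB U BU; have /closure_id <- := clB U BU.
  exact: balanced_sub_double.
Qed.
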